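(* Let $m,n$ be positive integers, $r=\min\{m,n\}$, $s\in\{0,1,\dots,r\}$, and let $S=\{y\in\mathbb{R}^{m\times n} : \operatorname{rank}(y)\le s\}$. The set $S$ is prox-regular at all points $\overline{x}\in\mathbb{R}^{m\times n}$ with $\operatorname{rank}(\overline{x})=s$.
   Context: $\mathbb{R}^{m\times n}$ carries the norm $\|x\|=\sqrt{\operatorname{Tr}(x^Tx)}$. For a set $\Omega$ in a Euclidean space, the (multivalued) projection is $P_\Omega(x)=\operatorname{argmin}_{z\in\Omega}\|z-x\|$. Definition: a nonempty closed set $\Omega$ in a Euclidean space is prox-regular at a point $\overline{x}\in\Omega$ if $P_\Omega(x)$ is single-valued around $\overline{x}$, i.e. for all $x$ in some neighborhood of $\overline{x}$. *)

(* Defs.v *)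
From HB Require Import structures.
From mathcomp Require Import all_boot all_order all_algebra.
From mathcomp Require Import all_classical all_reals all_analysis.

Set Implicit Arguments.
Unset Strict Implicit.
Unset Printing Implicit Defensive.

Import Order.TTheory GRing.Theory Num.Theory.
Import numFieldNormedType.Exports.

Local Open Scope classical_set_scope.
Local Open Scope ring_scope.

(* The norm carried by matrices in MathComp-Analysis is the sup norm of the
   entries, so the Euclidean norm has to be defined separately. Both induce the
   same topology, hence [closed] and [\near] below are the library's. *)
Definition frobenius_norm (R : realType) (m n : nat) (x : 'M[R]_(m, n)) : R :=
  Num.sqrt (\tr (x^T *m x)).

Definition projection (R : realType) (m n : nat)
    (Omega : set 'M[R]_(m, n)) (x : 'M[R]_(m, n)) : set 'M[R]_(m, n) :=
  [set z | Omega z /\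
    forall w, Omega w -> frobenius_norm (z - x) <= frobenius_norm (w - x)].

(* Nonemptiness of [Omega] is implied by [Omega xbar]. *)
Definition prox_regular (R : realType) (m n : nat)
    (Omega : set 'M[R]_(m, n)) (xbar : 'M[R]_(m, n)) : Prop :=
  [/\ closed Omega, Omega xbar &
      \forall x \near xbar, exists z, projection Omega x = [set z]].

Definition rank_le_set (R : realType) (m n s : nat) : set 'M[R]_(m, n) :=
  [set y | (\rank y <= s)%N].

(* Main.v *)
Require Import Defs.
From HB Require Import structures.
From mathcomp Require Import all_boot all_order all_algebra.
From mathcomp Require Import all_classical all_reals all_analysis.
From mathcomp Require Import ring lra.

Set Implicit Arguments.
Unset Strict Implicit.
Unset Printing Implicit Defensive.

Import Order.TTheory GRing.Theory Num.Theory.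
Import numFieldNormedType.Exports.

(** Let S be the set of matrices of rank at most [s].

    S is closed because the rank is lower semicontinuous: choose L and P with
    [L *m x *m P = 1%:M] of size [\rank x]; for y near x the product
    [L *m y *m P] is close to the identity, hence invertible, so
    [\rank x <= \rank y] ([near_mxrank_ge]). Projections onto a nonempty
    closed set exist by compactness ([projection_exists]).

    Uniqueness rests on a quadratic estimate. If z is a projection of x onto S,
    the residual e = x - z is normal to S at z: since S is stable under
    multiplication on either side, first-order optimality gives
    [e *m z^T = 0] and [z^T *m e = 0] ([projection_normal]). Let L and P be
    chosen for xbar, of rank exactly s. A matrix y of S near xbar then satisfies
    [y = y *m P *m N *m L *m y], where N is the inverse of [L *m y *m P]
    ([frame_factorization]). In the product <e, y P N L y> both outer copies of
    y may be replaced by y - z, because e annihilates z on both sides; hence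
    <e, y - z> <= C |e| |y - z|^2 with C uniform near xbar
    ([normal_hypomonotone]).

    If z and z' are both projections of x, with residuals e and e', adding the
    two estimates gives
      |z' - z|^2 = <e, z' - z> + <e', z - z'> <= 2 C |x - xbar| |z' - z|^2,
    since |e| and |e'| are at most |x - xbar|. For x close enough to xbar the
    constant is less than 1, and z' = z. *)

Local Open Scope classical_set_scope.
Local Open Scope ring_scope.

Local Notation fnorm := frobenius_norm.

(** * The Frobenius inner product and norm *)

Definition frob_dot (R : realType) (m n : nat) (x y : 'M[R]_(m, n)) : R :=
  \tr (x^T *m y).

Section Frobenius.
Variable R : realType.

Lemma sum_cauchy_schwarz (I : finType) (a b : I -> R) :
  (\sum_i a i * b i) ^+ 2 <= (\sum_i a i ^+ 2) * (\sum_i b i ^+ 2).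
Proof.
set A := \sum_i a i ^+ 2; set B := \sum_i b i ^+ 2; set C := \sum_i a i * b i.
have B0 : 0 <= B by apply: sumr_ge0 => i _; exact: sqr_ge0.
(* The discriminant argument, for the squared length of [a - t * b]. *)
have H (t : R) : 0 <= A - 2 * t * C + t ^+ 2 * B.
  have -> : A - 2 * t * C + t ^+ 2 * B = \sum_i (a i - t * b i) ^+ 2.
    rewrite /A /B /C !mulr_sumr -sumrN -!big_split /=.
    by apply: eq_bigr => i _; ring.
  by apply: sumr_ge0 => i _; exact: sqr_ge0.
have [B_eq0|B_neq0] := eqVneq B 0.
  suff -> : C = 0 by rewrite B_eq0 mulr0 expr0n.
  rewrite /C big1// => i _.
  have /eqP := B_eq0; rewrite psumr_eq0; last by move=> *; exact: sqr_ge0.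
  by move=> /allP /(_ i (mem_index_enum i)); rewrite sqrf_eq0 => /eqP ->; rewrite mulr0.
have Bgt0 : 0 < B by rewrite lt_def B_neq0.
(* [C / B] minimizes the quadratic polynomial in [t]. *)
have := H (C / B).
have -> : A - 2 * (C / B) * C + (C / B) ^+ 2 * B = (A * B - C ^+ 2) / B by field.
by rewrite pmulr_lge0 ?invr_gt0// subr_ge0.
Qed.

Lemma frob_dotE m n (x y : 'M[R]_(m, n)) :
  frob_dot x y = \sum_(p : 'I_m * 'I_n) x p.1 p.2 * y p.1 p.2.
Proof.
rewrite -(pair_bigA _ (fun i j => x i j * y i j)) exchange_big /=.
by apply: eq_bigr => j _; rewrite mxE; apply: eq_bigr => i _; rewrite mxE.
Qed.

Lemma frob_dotxxE m n (x : 'M[R]_(m, n)) :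
  frob_dot x x = \sum_(p : 'I_m * 'I_n) x p.1 p.2 ^+ 2.
Proof. by rewrite frob_dotE; apply: eq_bigr => p _; rewrite expr2. Qed.

Lemma frob_dotxx_ge0 m n (x : 'M[R]_(m, n)) : 0 <= frob_dot x x.
Proof. by rewrite frob_dotxxE; apply: sumr_ge0 => p _; exact: sqr_ge0. Qed.

Lemma fnorm_ge0 m n (x : 'M[R]_(m, n)) : 0 <= fnorm x.
Proof. exact: sqrtr_ge0. Qed.

Lemma fnorm_sqr m n (x : 'M[R]_(m, n)) : fnorm x ^+ 2 = frob_dot x x.
Proof. by rewrite sqr_sqrtr// frob_dotxx_ge0. Qed.

Lemma frob_dotDl m n (x y z : 'M[R]_(m, n)) :
  frob_dot (x + y) z = frob_dot x z + frob_dot y z.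
Proof. by rewrite /frob_dot linearD mulmxDl linearD. Qed.

Lemma frob_dotDr m n (x y z : 'M[R]_(m, n)) :
  frob_dot x (y + z) = frob_dot x y + frob_dot x z.
Proof. by rewrite /frob_dot mulmxDr linearD. Qed.

Lemma frob_dotNl m n (x y : 'M[R]_(m, n)) : frob_dot (- x) y = - frob_dot x y.
Proof. by rewrite /frob_dot linearN mulNmx linearN. Qed.

Lemma frob_dotZl m n (t : R) (x y : 'M[R]_(m, n)) :
  frob_dot (t *: x) y = t * frob_dot x y.
Proof. by rewrite /frob_dot linearZ -scalemxAl linearZ. Qed.

Lemma frob_dotC m n (x y : 'M[R]_(m, n)) : frob_dot x y = frob_dot y x.
Proof. by rewrite !frob_dotE; apply: eq_bigr => p _; rewrite mulrC. Qed.

Lemma frob_dotNr m n (x y : 'M[R]_(m, n)) : frob_dot x (- y) = - frob_dot x y.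
Proof. by rewrite frob_dotC frob_dotNl frob_dotC. Qed.

Lemma frob_dotZr m n (t : R) (x y : 'M[R]_(m, n)) :
  frob_dot x (t *: y) = t * frob_dot x y.
Proof. by rewrite frob_dotC frob_dotZl frob_dotC. Qed.

Lemma fnormB_sqr m n (x y : 'M[R]_(m, n)) :
  fnorm (x - y) ^+ 2 = frob_dot x x - 2 * frob_dot x y + frob_dot y y.
Proof.
rewrite fnorm_sqr frob_dotDl !frob_dotDr !frob_dotNl !frob_dotNr.
by rewrite (frob_dotC y x); ring.
Qed.

Lemma frob_dot_le m n (x y : 'M[R]_(m, n)) : frob_dot x y <= fnorm x * fnorm y.
Proof.
apply: (le_trans (ler_norm _)).
rewrite -(@ler_pXn2r _ 2)// ?nnegrE ?mulr_ge0 ?fnorm_ge0//.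
rewrite real_normK ?num_real// exprMn !fnorm_sqr !frob_dotxxE frob_dotE.
exact: sum_cauchy_schwarz.
Qed.

Lemma frob_dotxx_eq0 m n (x : 'M[R]_(m, n)) : frob_dot x x = 0 -> x = 0.
Proof.
rewrite frob_dotxxE => /eqP; rewrite psumr_eq0; last by move=> *; exact: sqr_ge0.
move=> /allP H; apply/matrixP => i j; have := H (i, j) (mem_index_enum _).
by rewrite sqrf_eq0 mxE => /eqP.
Qed.

Lemma fnorm_eq0 m n (x : 'M[R]_(m, n)) : fnorm x = 0 -> x = 0.
Proof. by move=> x0; apply: frob_dotxx_eq0; rewrite -fnorm_sqr x0 expr0n. Qed.

Lemma fnormN m n (x : 'M[R]_(m, n)) : fnorm (- x) = fnorm x.
Proof. by rewrite /fnorm [(- x)^T]linearN mulNmx mulmxN opprK. Qed.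

Lemma fnormBC m n (x y : 'M[R]_(m, n)) : fnorm (x - y) = fnorm (y - x).
Proof. by rewrite -opprB fnormN. Qed.

Lemma fnormD m n (x y : 'M[R]_(m, n)) : fnorm (x + y) <= fnorm x + fnorm y.
Proof.
rewrite -(@ler_pXn2r _ 2)// ?nnegrE ?addr_ge0 ?fnorm_ge0//.
rewrite sqrrD !fnorm_sqr frob_dotDl !frob_dotDr (frob_dotC y x).
have := frob_dot_le x y; lra.
Qed.

(** Cauchy-Schwarz for each pair of a row of [x] and a column of [y]. *)
Lemma fnormM m n p (x : 'M[R]_(m, n)) (y : 'M[R]_(n, p)) :
  fnorm (x *m y) <= fnorm x * fnorm y.
Proof.
rewrite -(@ler_pXn2r _ 2)// ?nnegrE ?mulr_ge0 ?fnorm_ge0//.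
rewrite exprMn !fnorm_sqr !frob_dotxxE.
rewrite -(pair_bigA _ (fun i j => (x *m y) i j ^+ 2)).
rewrite -(pair_bigA _ (fun i j => x i j ^+ 2)).
rewrite -(pair_bigA _ (fun i j => y i j ^+ 2)) exchange_big /=.
rewrite [X in _ <= _ * X]exchange_big /= exchange_big /= mulr_suml.
apply: ler_sum => i _; rewrite mulr_sumr; apply: ler_sum => j _.
by rewrite mxE; exact: sum_cauchy_schwarz.
Qed.

Lemma norm_coord_le m n (x : 'M[R]_(m, n)) i j : `|x i j| <= fnorm x.
Proof.
rewrite -(@ler_pXn2r _ 2)// ?nnegrE ?fnorm_ge0//.
rewrite real_normK ?num_real// fnorm_sqr frob_dotxxE (bigD1 (i, j))//= lerDl.
by apply: sumr_ge0 => p _; exact: sqr_ge0.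
Qed.

(** * Compatibility with the topology of matrices *)

(** The balls of the matrix topology are those of the sup norm, so an entrywise
    bound has to be turned into a bound on the sum of squares. *)
Lemma near_fnorm m n (x : 'M[R]_(m, n)) (e : R) : 0 < e ->
  \forall y \near x, fnorm (y - x) < e.
Proof.
(* The successor keeps [N] positive when a dimension vanishes, and the final
   inequality strict. *)
move=> e0; pose N : R := (m * n).+1%:R.
have N0 : 0 < N by rewrite ltr0n.
apply/nbhs_ballP; exists (e / N) => /=; first exact: divr_gt0.
move=> y [_ xy].
rewrite -(@ltr_pXn2r _ 2)// ?nnegrE ?fnorm_ge0 ?(ltW e0)//.
rewrite fnorm_sqr frob_dotxxE.
have le1 : \sum_(p : 'I_m * 'I_n) (y - x) p.1 p.2 ^+ 2 <=
    \sum_(p : 'I_m * 'I_n) (e / N) ^+ 2.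
  apply: ler_sum => p _; rewrite !mxE -real_normK ?num_real//.
  rewrite ler_pXn2r ?nnegrE ?normr_ge0 ?(ltW (divr_gt0 e0 N0))//; apply: ltW.
  by have := xy p.1 p.2; rewrite /ball /= distrC.
apply: (le_lt_trans le1).
rewrite sumr_const card_prod !card_ord -mulr_natl exprMn mulrCA.
rewrite -[ltRHS]mulr1 ltr_pM2l ?exprn_gt0// exprVn ltr_pdivrMr ?exprn_gt0//.
rewrite mul1r /N -natrX ltr_nat.
by rewrite (leq_trans (ltnSn _))// expnS expn1 leq_pmulr.
Qed.

Lemma fnorm_dist_continuous m n (x : 'M[R]_(m, n)) :
  continuous (fun w : 'M[R]_(m, n) => fnorm (w - x)).
Proof.
move=> w; apply: (proj2 (@cvgrPdist_lt _ _ _ (nbhs w) (nbhs_filter w) _ _)) => e e0.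
near=> y.
have yw : fnorm (y - w) < e by near: y; exact: near_fnorm.
apply: le_lt_trans yw; rewrite ler_norml.
have := fnormD (y - w) (w - x); have := fnormD (w - y) (y - x).
rewrite !subrKA (fnormBC w y) => h1 h2; apply/andP; split; lra.
Unshelve. all: by end_near.
Qed.

Lemma vec_mx_continuous m n : continuous (@vec_mx R m n).
Proof.
move=> v A /nbhs_ballP[e e0 eA]; apply/nbhs_ballP; exists e => // w [_ vw].
by apply: eA; split=> // i j; rewrite !mxE; exact: vw.
Qed.

(** * Inverses near the identity *)

(** With E = M - 1, a kernel vector u of M satisfies u = - u E, so |u| <= |u| / 2
    and u = 0. Likewise the inverse satisfies N = 1 - N E, so that
    |N| <= |1| + |N| / 2. The Frobenius norm of the identity is the square
    root of its size, whence the last factor. *)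
Lemma unitmx_near1 s (M : 'M[R]_s) : fnorm (M - 1%:M) <= 2^-1 ->
  M \in unitmx /\ fnorm (invmx M) <= 2 * fnorm (1%:M : 'M[R]_s).
Proof.
move=> M1.
have unitM : M \in unitmx.
  rewrite -row_free_unit; apply: inj_row_free => u uM0.
  have uE : u = u *m - (M - 1%:M) by rewrite mulmxN mulmxBr uM0 mulmx1 sub0r opprK.
  have := fnormM u (- (M - 1%:M)); rewrite -uE fnormN => h.
  apply: fnorm_eq0; have := fnorm_ge0 u; nra.
split=> //.
have NE : invmx M = 1%:M + invmx M *m - (M - 1%:M).
  by rewrite mulmxN mulmxBr mulVmx// mulmx1 opprB addrC subrK.
have := fnormD 1%:M (invmx M *m - (M - 1%:M)); rewrite -NE.
have := fnormM (invmx M) (- (M - 1%:M)); rewrite fnormN.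
have := fnorm_ge0 (invmx M); nra.
Qed.

End Frobenius.

(** * Closedness of the rank-bounded set *)

Section Rank.
Variable R : realType.

(** [L] is a left inverse of the column base in the full-rank factorization of
    [x], and [P] a right inverse of the row base. *)
Lemma rank_frame m n (x : 'M[R]_(m, n)) :
  exists (L : 'M[R]_(\rank x, m)) (P : 'M[R]_(n, \rank x)), L *m x *m P = 1%:M.
Proof.
have /row_fullP[L LC] := col_base_full x.
have /row_freeP[P RP] := row_base_free x.
exists L, P.
by rewrite -[X in _ *m X *m _](mulmx_base x) mulmxA LC mul1mx RP.
Qed.

Lemma frame_perturbation m n s (L : 'M[R]_(s, m)) (P : 'M[R]_(n, s))
    (x y : 'M[R]_(m, n)) : L *m x *m P = 1%:M ->
  fnorm (L *m y *m P - 1%:M) <= fnorm L * fnorm P * fnorm (y - x).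
Proof.
move=> <-; rewrite -mulmxBl -mulmxBr; apply: (le_trans (fnormM _ _)).
by rewrite mulrAC; apply: ler_wpM2r; [exact: fnorm_ge0|exact: fnormM].
Qed.

Lemma near_mxrank_ge m n (x : 'M[R]_(m, n)) :
  \forall y \near x, (\rank x <= \rank y)%N.
Proof.
have [L [P LxP]] := rank_frame x.
pose K := fnorm L * fnorm P + 1.
have K0 : 0 < K by rewrite ltr_wpDl// mulr_ge0// fnorm_ge0.
near=> y.
have yx : fnorm (y - x) < 2^-1 / K.
  by near: y; apply: near_fnorm; rewrite divr_gt0.
have [|unitM _] := @unitmx_near1 _ _ (L *m y *m P).
  apply: (le_trans (frame_perturbation y LxP)).
  move: yx; rewrite ltr_pdivlMr// /K.
  have := fnorm_ge0 (y - x); nra.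
rewrite -[X in (X <= _)%N](mxrank_unit unitM).
exact: leq_trans (mxrankM_maxl _ _) (mxrankM_maxr _ _).
Unshelve. all: by end_near.
Qed.

Lemma closed_rank_le m n s : closed (@rank_le_set R m n s).
Proof.
rewrite -[X in closed X]setCK; apply: open_closedC; rewrite openE => x /= xs.
near=> y => /= ys; apply: xs; apply: leq_trans ys.
by near: y; exact: near_mxrank_ge.
Unshelve. all: by end_near.
Qed.

(** * Existence of projections *)

(** The minimization may be restricted to the points at least as close to [x]
    as some given point of [Omega]. They form a closed bounded set; flattening
    the matrices into row vectors makes it compact. *)
Lemma projection_exists m n (Omega : set 'M[R]_(m, n)) (x : 'M[R]_(m, n)) :
  closed Omega -> Omega !=set0 -> projection Omega x !=set0.
Proof.
move=> clO [w0 Ow0].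
pose f w := fnorm (w - x).
pose K := Omega `&` [set w | f w <= f w0].
have clK : closed K.
  apply: closedI => //; apply: (@preimage_closed _ _ f [set r | r <= f w0]).
    by move=> w _; exact: fnorm_dist_continuous.
  exact: closed_le.
have compK : compact (vec_mx @^-1` K : set 'rV[R]_(m * n)).
  apply: bounded_closed_compact.
    exists (f w0 + fnorm x); split; first exact: num_real.
    move=> M hM v /= [_ Kv]; rewrite [leLHS]/Num.Def.normr /= mx_normrE.
    have M0 : 0 <= M by apply: ltW; apply: le_lt_trans hM; rewrite addr_ge0// fnorm_ge0.
    apply: bigmax_le => // -[i j] _ /=.
    rewrite (ord1 i) -[v]vec_mxK; case/mxvec_indexP: j => k l; rewrite mxvecE.
    apply: (le_trans (norm_coord_le _ _ _)); apply: ltW; apply: le_lt_trans hM.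
    rewrite -[X in fnorm X](subrK x); apply: (le_trans (fnormD _ _)).
    by rewrite lerD2r.
  by apply: preimage_closed => // v _; exact: vec_mx_continuous.
have [||c] := @compact_EVT_min _ R (f \o vec_mx) _ _ compK.
- by exists (mxvec w0); rewrite /= mxvecK; split => //=.
- apply: continuous_subspaceT => v; apply: continuous_comp.
    exact: vec_mx_continuous.
  exact: fnorm_dist_continuous.
rewrite inE => -[Oc cw0] cmin; exists (vec_mx c); split=> // w Ow.
have [ww0|/ltW w0w] := leP (f w) (f w0).
  have := cmin (mxvec w); rewrite inE /= mxvecK; apply.
  by split.
exact: le_trans cw0 w0w.
Qed.

(** * The residual of a projection is normal *)

(** If [Omega] contains a line through [z], the squared distance to [x] along
    it is a quadratic polynomial minimal at 0, so its linear term vanishes. *)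
Lemma projection_stationary m n (Omega : set 'M[R]_(m, n)) (x z d : 'M[R]_(m, n)) :
  projection Omega x z -> (forall t, Omega (z + t *: d)) ->
  frob_dot d (x - z) = 0.
Proof.
move=> [_ zmin] Od; set e := x - z; set a := frob_dot d e; set b := frob_dot d d.
have b0 : 0 <= b by exact: frob_dotxx_ge0.
have H t : 2 * t * a <= t ^+ 2 * b.
  have := zmin _ (Od t); rewrite -(@ler_pXn2r _ 2)// ?nnegrE ?fnorm_ge0//.
  rewrite (fnormBC z) (_ : z + t *: d - x = t *: d + - e); last first.
    by rewrite /e opprB addrAC addrC.
  rewrite (fnormB_sqr (t *: d)) fnorm_sqr !frob_dotZl !frob_dotZr -/e -/a -/b; lra.
have b1 : 0 < b + 1 by rewrite ltr_wpDl.
(* [b + 1] rather than the optimal [b], which may be zero. *)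
have := H (a / (b + 1)).
have -> : 2 * (a / (b + 1)) * a = 2 * (b + 1) * (a / (b + 1)) ^+ 2.
  by field; rewrite gt_eqF.
have := sqr_ge0 (a / (b + 1)) => q0 q1.
have /eqP : (a / (b + 1)) ^+ 2 = 0 by nra.
by rewrite sqrf_eq0 mulf_eq0 invr_eq0 (gt_eqF b1) orbF => /eqP.
Qed.

(** The lines z + t W z and z + t z W stay inside the rank-bounded set. With
    W = e z^T, resp. W = z^T e, stationarity along them says exactly that the
    squared norm of e z^T, resp. z^T e, is zero. *)
Lemma projection_normal m n s (x z : 'M[R]_(m, n)) :
  projection (@rank_le_set R m n s) x z ->
  (x - z) *m z^T = 0 /\ z^T *m (x - z) = 0.
Proof.
move=> pz; have [rz _] := pz.
set e := x - z; split.
  apply: frob_dotxx_eq0.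
  rewrite -[RHS](@projection_stationary _ _ _ x z (e *m z^T *m z) pz).
    rewrite -/e /frob_dot !trmx_mul !trmxK.
    by rewrite mxtrace_mulC [RHS]mxtrace_mulC !mulmxA.
  move=> t; apply: leq_trans rz.
  rewrite -[X in (X + _)](mul1mx z) scalemxAl -mulmxDl; exact: mxrankM_maxr.
apply: frob_dotxx_eq0.
rewrite -[RHS](@projection_stationary _ _ _ x z (z *m (z^T *m e)) pz).
  by rewrite -/e /frob_dot !trmx_mul !trmxK !mulmxA.
move=> t; apply: leq_trans rz.
rewrite -[X in (X + _)](mulmx1 z) scalemxAr -mulmxDr; exact: mxrankM_maxl.
Qed.

(** * Hypomonotonicity of the normals *)

(** Since [L *m y *m P] has rank [s], so does [L *m y], whose row space is
    therefore the whole row space of [y]: there is D with y = D (L y).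
    Multiplying by [P] on the right determines D. *)
Lemma frame_factorization m n s (L : 'M[R]_(s, m)) (P : 'M[R]_(n, s))
    (y : 'M[R]_(m, n)) :
  (\rank y <= s)%N -> L *m y *m P \in unitmx ->
  y = y *m P *m invmx (L *m y *m P) *m (L *m y).
Proof.
move=> ys; set M := L *m y *m P => unitM.
have sM : (s <= \rank (L *m y))%N.
  by rewrite -{1}(mxrank_unit unitM); exact: mxrankM_maxl.
have /submxP[D yD] : (y <= L *m y)%MS.
  have [_ <-] := mxrank_leqif_sup (submxMl L y).
  by rewrite eqn_leq (mxrankM_maxr L y) (leq_trans ys sM).
have -> : y *m P *m invmx M = D; last exact: yD.
by rewrite {1}yD -(mulmxA D) -/M mulmxK.
Qed.

(** A normal [e] at [z] kills both the row and the column space of [z], so in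
    the pairing of [e] with the factorization of [y] both outer factors [y] can
    be replaced by [y - z]: the pairing is quadratic in [y - z]. *)
Lemma normal_hypomonotone m n s (L : 'M[R]_(s, m)) (P : 'M[R]_(n, s))
    (y z e : 'M[R]_(m, n)) :
  (\rank y <= s)%N -> L *m y *m P \in unitmx ->
  e *m z^T = 0 -> z^T *m e = 0 ->
  frob_dot e (y - z) <=
    fnorm e * (fnorm P * fnorm (invmx (L *m y *m P)) * fnorm L)
      * fnorm (y - z) ^+ 2.
Proof.
move=> ys unitM ezT zTe; set N := invmx _; set d := y - z.
have eTz : e^T *m z = 0 by rewrite -[z]trmxK -trmx_mul zTe trmx0.
have zeT : z *m e^T = 0 by rewrite -[z]trmxK -trmx_mul ezT trmx0.
have -> : frob_dot e d = frob_dot e (d *m P *m N *m L *m d).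
  have -> : frob_dot e d = frob_dot e y.
    by rewrite /frob_dot mulmxBr eTz subr0.
  have yE : y = y *m P *m N *m L *m y.
    by rewrite -(mulmxA _ L); exact: frame_factorization.
  have eTd : e^T *m d = e^T *m y by rewrite mulmxBr eTz subr0.
  have deT : d *m e^T = y *m e^T by rewrite mulmxBl zeT subr0.
  rewrite [in LHS]yE /frob_dot !mulmxA eTd mxtrace_mulC [in RHS]mxtrace_mulC.
  by rewrite !mulmxA deT.
apply: (le_trans (frob_dot_le _ _)); rewrite -mulrA.
apply: ler_wpM2l; first exact: fnorm_ge0.
apply: (le_trans (fnormM _ _)); rewrite expr2 mulrA.
apply: ler_wpM2r; first exact: fnorm_ge0.
apply: (le_trans (fnormM _ _)); rewrite mulrAC.
apply: ler_wpM2r; first exact: fnorm_ge0.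
apply: (le_trans (fnormM _ _)); rewrite mulrAC.
apply: ler_wpM2r; first exact: fnorm_ge0.
by rewrite mulrC; exact: fnormM.
Qed.

End Rank.

(** * Prox-regularity *)

Theorem proposition3p8 (R : realType) (m n s : nat)
    (hm : (0 < m)%N) (hn : (0 < n)%N) (hs : (s <= minn m n)%N)
    (xbar : 'M[R]_(m, n)) (hxbar : \rank xbar = s) :
  prox_regular (@rank_le_set R m n s) xbar.
Proof.
have xbarS : rank_le_set s xbar by rewrite /rank_le_set /= hxbar.
split; [exact: closed_rank_le | exact: xbarS |].
have := rank_frame xbar; rewrite hxbar => -[L [P LP1]].
pose K := fnorm L * fnorm P; pose c := fnorm (1%:M : 'M[R]_s).
have K0 : 0 <= K by rewrite mulr_ge0// fnorm_ge0.
have c0 : 0 <= c by exact: fnorm_ge0.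
(* [4 K eps < 1] brings [L *m z *m P] within 1/2 of the identity for every
   projection [z], and [4 K c eps < 1] makes the final constant less than 1.
   Both hold when [eps * D < 1], where [eps] is the distance of [x] to [xbar]. *)
pose D := 4 * (K * (1 + c)) + 1.
have D0 : 0 < D by rewrite /D; nra.
near=> x.
have xnear : fnorm (x - xbar) < D^-1.
  by near: x; apply: near_fnorm; rewrite invr_gt0.
have {xnear} : fnorm (x - xbar) * D < 1 by rewrite -ltr_pdivlMr// div1r.
set eps := fnorm (x - xbar) => epsD.
have eps0 : 0 <= eps by exact: fnorm_ge0.
have epsK0 : 0 <= eps * K by exact: mulr_ge0.
have epsKc0 : 0 <= eps * K * c by exact: mulr_ge0.
have epsK : 4 * (eps * K) < 1 by move: epsD; rewrite /D; lra.
have epsKc : 4 * (eps * K * c) < 1 by move: epsD; rewrite /D; lra.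
have close z : projection (rank_le_set s) x z -> fnorm (x - z) <= eps.
  by move=> [_ /(_ _ xbarS)]; rewrite (fnormBC z) (fnormBC xbar).
have hypo z z' : projection (rank_le_set s) x z -> projection (rank_le_set s) x z' ->
    frob_dot (x - z) (z' - z) <= eps * (2 * K * c) * fnorm (z' - z) ^+ 2.
  move=> pz pz'; have [ezT zTe] := projection_normal pz.
  have z'near : fnorm (z' - xbar) <= 2 * eps.
    rewrite -(subrKA x); apply: (le_trans (fnormD _ _)).
    have := close _ pz'; rewrite fnormBC -/eps; lra.
  have [|unitM leN] := @unitmx_near1 _ _ (L *m z' *m P).
    apply: (le_trans (frame_perturbation _ LP1)); rewrite -/K.
    by apply: le_trans (ler_wpM2l K0 z'near) _; lra.
  have [rz' _] := pz'.
  apply: (le_trans (normal_hypomonotone rz' unitM ezT zTe)).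
  apply: ler_wpM2r; first exact: exprn_ge0 (fnorm_ge0 _).
  apply: ler_pM; rewrite ?fnorm_ge0 ?mulr_ge0 ?fnorm_ge0//.
    exact: close.
  rewrite mulrAC (mulrC (fnorm P)) -/K (mulrC 2) -(mulrA K).
  exact: ler_wpM2l.
have [z pz] := projection_exists x (@closed_rank_le R m n s) (ex_intro _ _ xbarS).
exists z; apply/seteqP; split=> [z' pz'|z' ->] //=.
apply/eqP; rewrite -subr_eq0; apply/eqP/fnorm_eq0.
have h1 := hypo _ _ pz pz'; have h2 := hypo _ _ pz' pz.
have sqE : fnorm (z' - z) ^+ 2 =
    frob_dot (x - z) (z' - z) + frob_dot (x - z') (z - z').
  rewrite fnorm_sqr -[z - z']opprB frob_dotNr -frob_dotNl -frob_dotDl.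
  by congr frob_dot; rewrite opprB [RHS]addrC subrKA.
rewrite (fnormBC z) in h2.
have q0 : 0 <= fnorm (z' - z) ^+ 2 by exact: exprn_ge0 (fnorm_ge0 _).
have /eqP : fnorm (z' - z) ^+ 2 = 0 by nra.
by rewrite sqrf_eq0 => /eqP.
Unshelve. all: by end_near.
Qed.
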